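(* Let $X$ be a countable set with at least two elements, let $\mathcal{B}=(\underline{B},E)$ be a condition set for $X^\omega$ with $\underline{B}$ countable, and let $A\subset X^\omega$. Then: (i) Player I has a winning strategy in the game $G^{\mathcal{B}}(A)$ if and only if $A$ contains a nonempty $\mathcal{B}$-perfect subset. (ii) Player II has a winning strategy in the game $G^{\mathcal{B}}(A)$ if and only if $A$ is $\mathcal{B}$-meager.
   Context: $X^{<\omega}$ is the set of finite sequences in $X$, $X^{<\omega}_*$ the set of nonempty ones; $u\prec v$ means $u$ is an initial segment of $v$ (possibly equal; $v$ may be infinite); the dot in $u\cdot v$ denotes concatenation of sequences. $X^\omega$ carries the topology with basic open sets $O_u=\{f\in X^\omega: u\prec f\}$. For $A\subset X^\omega$, $T_A$ is the set of finite initial segments of elements of $A$. Condition set: Let $\underline{B}$ be a nonempty set (of ''conditions'') and $E$ a function assigning to each $b\in\underline{B}$ a nonempty set $E(b)\subset X^{<\omega}_*$; write $u\Vdash b$ for $u\in E(b)$. $\mathcal{B}=(\underline{B},E)$ is a condition set for $X^\omega$ if: (1) for all $u,v\in X^{<\omega}_*$, $b\in\underline{B}$: $u\prec v$ and $u\Vdash b$ imply $v\Vdash b$; (2) for every $x\in X$ there is $b\in\underline{B}$ such that for all $u\in X^{<\omega}_*$: $u\Vdash b$ implies $u(0)\neq x$; (3) there is a map $l:\underline{B}\to\omega$ such that for all $b\in\underline{B}$ and $u,v\in X^{<\omega}_*$ with $u\prec v$, $u\not\Vdash b$, $v\Vdash b$, there is $b'\in\underline{B}$ with $l(b')<l(b)$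 and, for all $w\in X^{<\omega}_*$, $w\Vdash b'\Leftrightarrow u\cdot w\Vdash b$. $\mathcal{B}$-meager: A closed set $D\subset X^\omega$ is $\mathcal{B}$-nowhere dense if for every $u\in T_D$ there is $b\in\underline{B}$ such that for all $v\in X^{<\omega}_*$: $u\cdot v\in T_D$ implies $v\not\Vdash b$. A set $A\subset X^\omega$ is $\mathcal{B}$-meager if it is contained in a countable union of (closed) $\mathcal{B}$-nowhere dense sets. $\mathcal{B}$-perfect: A tree $J$ on $X^{<\omega}$ is a subset of $(X^{<\omega})^{<\omega}$ closed under initial segments; $J_*$ is $J$ without the empty sequence. $J$ is $\mathcal{B}$-perfect if (1) for all $p\in J_*$ and $b\in\underline{B}$ there are $u\in X^{<\omega}_*$ and $u'\succ u$ with $p\cdot(u)\in J$ and $u'\Vdash b$; and (2) for all $p\in J$, if $p\cdot(u),p\cdot(v)\in J$ and $u\ne v$, then $u,v$ are incompatible (neither is an initial segment of the other). For such $J$, $[J]=\{f\in X^\omega:\forall n<\omega\ \exists(s_0,\ldots,s_n)\in J\ (s_0\cdots s_n\prec f)\}$, where $s_0\cdots s_n$ is the concatenation of $s_0,\ldots,s_n$. A set is $\mathcal{B}$-perfect if it equals $[J]$ for some $\mathcal{B}$-perfect tree $J$ on $X^{<\omega}$. The game $G^{\mathcal{B}}(A)$: with perfect information, I plays $u_0$, II plays $b_1$, I plays $u_1$, II plays $b_2$, I plays $u_2$, and so on, with $u_i\in X^{<\omega}_*$ and $b_i\in\underline{B}$. I wins if $u_0\cdot u_1\cdot u_2\cdots\in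 A$ and $u_i\Vdash b_i$ for all $i\ge1$; otherwise II wins. *)

(* Defs.v *)
From HB Require Import structures.
From mathcomp Require Import all_boot all_classical topology.

Set Implicit Arguments.
Unset Strict Implicit.
Unset Printing Implicit Defensive.

Local Open Scope classical_set_scope.

Definition omega_seq (X : Type) : Type := nat -> X.

(* X^{<omega}_*, used as the type of moves of player I *)
Definition nonempty_seq (X : eqType) : Type := {u : seq X | u != [::]}.

(* u is an initial segment of the infinite sequence f *)
Definition oprefix (X : eqType) (u : seq X) (f : omega_seq X) : bool :=
  mkseq f (size u) == u.

Definition cyl (X : eqType) (u : seq X) : set (omega_seq X) :=
  [set f | oprefix u f].

Section Topology.
Variable X : choiceType.

HB.instance Definition _ := gen_eqMixin (omega_seq X).
HB.instance Definition _ := gen_choiceMixin (omega_seq X).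
HB.instance Definition _ := isPointed.Build (seq X) [::].

Lemma cyl_cover : \bigcup_(u in [set: seq X]) cyl u = [set: omega_seq X].
Proof. by apply/seteqP; split=> // f _; exists [::]. Qed.

Lemma oprefix_mono (u v : seq X) (f : omega_seq X) :
  oprefix u f -> oprefix v f -> (size u <= size v)%N -> prefix u v.
Proof.
move=> /eqP fu /eqP fv le_uv.
by rewrite prefixE -fv -fu size_mkseq /mkseq -map_take take_iota (minn_idPl le_uv).
Qed.

Lemma oprefix_prefix (u v : seq X) (f : omega_seq X) :
  prefix u v -> oprefix v f -> oprefix u f.
Proof.
move=> /prefixP[w ->] /eqP /(congr1 (take (size u))).
rewrite take_size_cat // /mkseq -map_take take_iota size_cat.
by rewrite (minn_idPl (leq_addr _ _)) => fu; apply/eqP.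
Qed.

Lemma cyl_join (u v : seq X) (f : omega_seq X) :
  [set: seq X] u -> [set: seq X] v -> cyl u f -> cyl v f ->
  exists w, [/\ [set: seq X] w, cyl w f & cyl w `<=` cyl u `&` cyl v].
Proof.
move=> _ _ uf vf; case: (leqP (size u) (size v)) => [le_uv|/ltnW le_vu].
  exists v; split=> // g vg; split=> //.
  exact: oprefix_prefix (oprefix_mono uf vf le_uv) vg.
exists u; split=> // g ug; split=> //.
exact: oprefix_prefix (oprefix_mono vf uf le_vu) ug.
Qed.

(* The sets cyl u are the basic open sets. *)
HB.instance Definition _ :=
  isBaseTopological.Build (omega_seq X) cyl_cover cyl_join.

End Topology.

(* T_A *)
Definition segments (X : eqType) (A : set (omega_seq X)) : set (seq X) :=
  [set u | exists2 f, A f & oprefix u f].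

(* E b u reads "u forces b". *)
Record condition_set (X : eqType) (B : Type) (E : B -> set (seq X)) : Prop :=
  ConditionSet {
  cond_nonempty : [set: B] !=set0 ;
  forcing_nonempty : forall b, E b !=set0 ;
  forcing_sub : forall b, E b `<=` [set u | u != [::]] ;
  forcing_mono : forall u v b, u != [::] -> v != [::] ->
    prefix u v -> E b u -> E b v ;
  (* the head x' of x' :: w is the entry of index 0 *)
  forcing_avoid : forall x, exists b, forall x' w, E b (x' :: w) -> x' <> x ;
  forcing_rank : exists l : B -> nat, forall b u v,
    u != [::] -> v != [::] -> prefix u v -> ~ E b u -> E b v ->
    exists b', (l b' < l b)%N /\
      forall w, w != [::] -> (E b' w <-> E b (u ++ w))
}.

Definition B_nowhere_dense (X : choiceType) (B : Type) (E : B -> set (seq X))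
    (D : set (omega_seq X)) : Prop :=
  closed D /\
  forall u, segments D u ->
    exists b, forall v, v != [::] -> segments D (u ++ v) -> ~ E b v.

(* The empty set is B-nowhere dense, so unions indexed by nat include the
   finite and empty ones. *)
Definition B_meager (X : choiceType) (B : Type) (E : B -> set (seq X))
    (A : set (omega_seq X)) : Prop :=
  exists D : nat -> set (omega_seq X),
    (forall n, B_nowhere_dense E (D n)) /\ A `<=` \bigcup_n D n.

Definition is_tree (Y : eqType) (J : set (seq Y)) : Prop :=
  forall p q, prefix p q -> J q -> J p.

Record B_perfect_tree (X : eqType) (B : Type) (E : B -> set (seq X))
    (J : set (seq (seq X))) : Prop := BPerfectTree {
  perfect_is_tree : is_tree J ;
  perfect_split : forall p b, J p -> p != [::] ->
    exists u u', [/\ u != [::], prefix u u', J (rcons p u) & E b u'] ;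
  perfect_incompatible : forall p u v, J p -> J (rcons p u) -> J (rcons p v) ->
    u <> v -> ~ prefix u v /\ ~ prefix v u
}.

(* [J] *)
Definition branches (X : eqType) (J : set (seq (seq X))) : set (omega_seq X) :=
  [set f | forall n, exists s, [/\ J s, size s = n.+1 & oprefix (flatten s) f]].

Definition B_perfect (X : eqType) (B : Type) (E : B -> set (seq X))
    (P : set (omega_seq X)) : Prop :=
  exists2 J, B_perfect_tree E J & P = branches J.

Section Game.
Variables (X : eqType) (B : Type) (E : B -> set (seq X)).
Variable A : set (omega_seq X).

(* A play u_0, b_1, u_1, b_2, u_2, ... is a pair of sequences u and b, where
   b i is the move b_(i+1); the b's are thus shifted by one. *)

(* f = u_0 u_1 u_2 ...; f is determined by u because the u_i are nonempty. *)
Definition is_concat (u : nat -> nonempty_seq X) (f : omega_seq X) : Prop :=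
  forall n, oprefix (flatten (mkseq (fun i => sval (u i)) n)) f.

Definition I_wins_play (u : nat -> nonempty_seq X) (b : nat -> B) : Prop :=
  (exists2 f, A f & is_concat u f) /\ forall i, E (b i) (sval (u i.+1)).

(* (u_0, b_1), ..., (u_(n-1), b_n) *)
Definition history (u : nat -> nonempty_seq X) (b : nat -> B) (n : nat) :
    seq (nonempty_seq X * B) :=
  mkseq (fun i => (u i, b i)) n.

Definition I_has_winning_strategy : Prop :=
  exists sigma : seq (nonempty_seq X * B) -> nonempty_seq X,
  forall u b, (forall n, u n = sigma (history u b n)) -> I_wins_play u b.

Definition II_has_winning_strategy : Prop :=
  exists tau : seq (nonempty_seq X * B) -> nonempty_seq X -> B,
  forall u b, (forall n, b n = tau (history u b n) (u n)) -> ~ I_wins_play u b.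

End Game.

(* Main.v *)
Require Import Defs.
From mathcomp Require Import all_boot all_classical topology.

(** Both equivalences are instances of the unfolding of a Banach-Mazur game.

    Player I, from a strategy to a perfect set.  After a position, the replies
    of the strategy to the various conditions need not be pairwise
    incompatible, but the prefix-minimal ones among them are, and every reply
    extends a minimal one ([minimal_antichain]).  Keeping one condition for
    each minimal reply gives a tree of positions; its nodes split as required
    because each discarded reply [u'], which forces its condition, has a kept
    prefix [u].  Incompatibility makes a branch determine the play that
    produced it, so the branch is won by I and lies in [A]
    ([perfect_of_strategy]).

    Player I, from a perfect set to a strategy.  At a node, the tree only
    offers a child [u] of which some extension forces the condition [b].  If
    [u] does not force [b], the rank axiom replaces [b] by the residual
    condition after [u], which has smaller rank; so finitely many steps along
    the tree force [b] ([perfect_tree_forces]), and I stays in the tree.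

    Player II, from a strategy to meagerness.  Call a position live for [f] if
    the moves so far follow [f] and some further segment of [f] forces the
    pending condition.  If [f] is in [A], then I cannot keep a play live for
    [f] forever.  So there are a history [h] and a segment [u] of [f] after [h]
    that forces the pending condition, such that no extension [t] of [u] along
    [f] gets an answer [tau h t] that a later segment of [f] forces.  The
    sequences [f] with this property for fixed [h] and [u] form a closed set
    ([refuting]).  At a segment beyond [u], it is refuted by the answer of
    [tau] there; at a shorter one, by a condition that forbids the next entry
    on the way to [u].  So it is nowhere dense ([refuting_nowhere_dense]), and
    there are countably many pairs [(h, u)] ([meager_of_strategy]).  It would
    not do to fix [h] alone, and collect the [f] for which the pending
    condition is never forced: when no segment through some string can force
    that condition, this set contains a whole basic open set.

    Player II, from meagerness to a strategy.  With the n-th move, II names a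
    condition that takes the play out of the n-th nowhere dense set
    ([strategy_of_meager]). *)

Set Implicit Arguments.
Unset Strict Implicit.
Unset Printing Implicit Defensive.

Local Open Scope classical_set_scope.

(** * Initial segments of infinite sequences *)

Section Segments.
Variable X : eqType.
Implicit Types (f g : omega_seq X) (u v : seq X).

Lemma oprefix_mkseq f n : oprefix (mkseq f n) f.
Proof. by rewrite /oprefix size_mkseq. Qed.

Lemma oprefix_nth x0 u : oprefix u (nth x0 u).
Proof. by rewrite /oprefix mkseq_nth. Qed.

Lemma nth_oprefix x0 u f n : oprefix u f -> n < size u -> nth x0 u n = f n.
Proof. by move=> /eqP uf nu; rewrite -uf nth_mkseq. Qed.

Lemma oprefix_inj f g :
  (forall n, exists u, [/\ n < size u, oprefix u f & oprefix u g]) -> f = g.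
Proof.
move=> fg; apply/funext => n; have [u [nu uf ug]] := fg n.
by rewrite -(nth_oprefix (f n) uf nu) (nth_oprefix (f n) ug nu).
Qed.

Lemma prefix_neq0 u v : prefix u v -> u != [::] -> v != [::].
Proof. by case: u v => [|x u] []. Qed.

Lemma prefix_cat_cancel s u v : prefix (s ++ u) (s ++ v) = prefix u v.
Proof. by rewrite prefix_catr // eqxx. Qed.

End Segments.

Lemma oprefix_comparable (X : choiceType) (u v : seq X) (f : omega_seq X) :
  oprefix u f -> oprefix v f -> prefix u v \/ prefix v u.
Proof.
move=> uf vf; case: (leqP (size u) (size v)) => [|/ltnW] le_uv.
  by left; exact: oprefix_mono uf vf le_uv.
by right; exact: oprefix_mono vf uf le_uv.
Qed.

(** * Plays *)

Definition move_of (X : eqType) (u : seq X) (u_neq0 : u != [::]) :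
  nonempty_seq X := exist _ u u_neq0.

Section Plays.
Variables (X : eqType) (B : Type).
Implicit Types (u : nat -> nonempty_seq X) (b : nat -> B).

Definition concat_upto u n : seq X := flatten (mkseq (fun i => sval (u i)) n).

Lemma concat_uptoS u n : concat_upto u n.+1 = concat_upto u n ++ sval (u n).
Proof. by rewrite /concat_upto mkseqS flatten_rcons. Qed.

Lemma size_concat_upto u n : n <= size (concat_upto u n).
Proof.
elim: n => // n IHn; rewrite concat_uptoS size_cat -addn1 leq_add //.
by case: (u n) => -[].
Qed.

Lemma concat_upto_prefix u m n :
  m <= n -> prefix (concat_upto u m) (concat_upto u n).
Proof.
move=> /subnK <-; elim: (n - m) => [|k IHk]; first exact: prefix_refl.
by rewrite addSn concat_uptoS (prefix_trans IHk) // prefix_prefix.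
Qed.

Lemma is_concat_exists u : exists f, is_concat u f.
Proof.
have [x0 _] : exists x0 : X, true by case: (u 0) => -[//|x0 s] _; exists x0.
exists (fun n => nth x0 (concat_upto u n.+1) n) => n.
rewrite -/(concat_upto u n); apply/eqP/(@eq_from_nth _ x0).
  by rewrite size_mkseq.
rewrite size_mkseq => i i_lt; rewrite nth_mkseq //.
have i_lt' := size_concat_upto u i.+1.
case: (leqP i.+1 n) => [le_in|/ltnW le_ni].
  have /prefixP[t ->] := concat_upto_prefix u le_in.
  by rewrite nth_cat i_lt'.
have /prefixP[t ->] := concat_upto_prefix u le_ni.
by rewrite nth_cat i_lt.
Qed.

Lemma is_concat_inj u f g : is_concat u f -> is_concat u g -> f = g.
Proof.
move=> uf ug; apply: oprefix_inj => n; exists (concat_upto u n.+1).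
by split; [exact: size_concat_upto | exact: uf | exact: ug].
Qed.

Lemma historyS u b n : history u b n.+1 = rcons (history u b n) (u n, b n).
Proof. exact: mkseqS. Qed.

Lemma size_history u b n : size (history u b n) = n.
Proof. exact: size_mkseq. Qed.

Lemma flatten_history u b n :
  flatten [seq sval x.1 | x <- history u b n] = concat_upto u n.
Proof. by rewrite /history /concat_upto /mkseq -map_comp. Qed.

Lemma play_of_strategies (sigma : seq (nonempty_seq X * B) -> nonempty_seq X)
    (tau : seq (nonempty_seq X * B) -> nonempty_seq X -> B) :
  exists u b, (forall n, u n = sigma (history u b n)) /\
              (forall n, b n = tau (history u b n) (u n)).
Proof.
pose move_at h := (sigma h, tau h (sigma h)).
pose H n := iter n (fun h => rcons h (move_at h)) [::].
pose u n := (move_at (H n)).1; pose b n := (move_at (H n)).2.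
have histE n : history u b n = H n by elim: n => // n IHn; rewrite historyS IHn.
by exists u, b; split=> n; rewrite histE.
Qed.

End Plays.

(** * From a winning strategy of I to a perfect set *)

(** The shortest prefix of [r d] that is a value of [r] is prefix-minimal among
    the values of [r]; [S] keeps one preimage of each minimal value. *)
Lemma minimal_antichain (X : eqType) (C : Type) (r : C -> seq X) :
  exists S : set C,
    (forall c d, S c -> S d -> prefix (r c) (r d) -> c = d) /\
    (forall d, exists2 c, S c & prefix (r c) (r d)).
Proof.
pose minimal s := range r s /\ forall t, range r t -> prefix t s -> t = s.
have has_minimal d : exists2 s, minimal s & prefix s (r d).
  have ex_n : exists n, `[< range r (take n (r d)) >].
    by exists (size (r d)); apply/asboolP; rewrite take_size; exists d.
  case: (ex_minnP ex_n) => n /asboolP rn n_min.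
  exists (take n (r d)); last exact: prefix_take.
  split=> // t rt ts; have /eqP tE : take (size t) (r d) == t.
    by rewrite -prefixE; exact: prefix_trans ts (prefix_take _ _).
  have le_nt : n <= size t by apply: n_min; apply/asboolP; rewrite tE.
  move: ts; rewrite prefixE => /eqP <-.
  by rewrite take_oversize // size_take_min (leq_trans (geq_minl _ _)).
have preimage (s : {s | minimal s}) : exists c, r c = sval s.
  by have [[c _ rc] _] := svalP s; exists c.
have [rep repE] := choice preimage.
exists (range rep); split=> [c d [s _ <-] [t _ <-]|d].
  rewrite !repE => st; congr rep; case: s t st => [s s_min] [t t_min] /= st.
  by apply: eq_exist; exact: t_min.2 s_min.1 st.
have [s s_min sd] := has_minimal d.
by exists (rep (exist _ s s_min)); [exists (exist _ s s_min) | rewrite repE].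
Qed.

Section StrategyOfI.
Variables (X : choiceType) (B : Type) (E : B -> set (seq X)).
Variable A : set (omega_seq X).
Variable sigma : seq (nonempty_seq X * B) -> nonempty_seq X.
Implicit Types (h : seq (nonempty_seq X * B)).
Implicit Types (S : seq (nonempty_seq X * B) -> set B).

Definition extend h c := rcons h (sigma h, c).

Inductive history_along S : seq (nonempty_seq X * B) -> Prop :=
| along_nil : history_along S [::]
| along_extend h c : history_along S h -> S h c -> history_along S (extend h c).

(** The moves of I at [h] together with the next one; they form a nonempty
    sequence, so the root of the tree of positions corresponds to no history. *)
Definition position h : seq (seq X) :=
  rcons [seq sval x.1 | x <- h] (sval (sigma h)).

Lemma position_extend h c :
  position (extend h c) = rcons (position h) (sval (sigma (extend h c))).
Proof. by rewrite /position map_rcons. Qed.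

Lemma flatten_position_extend h c :
  flatten (position (extend h c)) =
  flatten (position h) ++ sval (sigma (extend h c)).
Proof. by rewrite position_extend flatten_rcons. Qed.

Lemma position_history u b n : (forall n, u n = sigma (history u b n)) ->
  position (history u b n) = mkseq (fun i => sval (u i)) n.+1.
Proof.
by move=> uE; rewrite /position -uE mkseqS /history /mkseq -map_comp.
Qed.

Definition strategy_tree S : set (seq (seq X)) :=
  [set p | p = [::] \/ exists2 h, history_along S h & p = position h].

Lemma history_along_play S h c : history_along S h ->
  exists u b, [/\ forall n, u n = sigma (history u b n),
                  history u b (size h) = h & b (size h) = c].
Proof.
move=> h_along.
have [u [b [uE bE]]] := play_of_strategies sigma
  (fun g _ => nth c [seq x.2 | x <- h] (size g)).
exists u, b; split=> //; last first.
  by rewrite bE size_history nth_default // size_map.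
suff initial g : history_along S g -> forall t, h = g ++ t ->
    history u b (size g) = g by apply: (initial h) (esym (cats0 h)).
elim=> {g} [//|g d _ IHg _] t hE; rewrite /extend cat_rcons in hE.
have gE := IHg _ hE; rewrite size_rcons historyS uE bE gE hE map_cat nth_cat.
by rewrite size_map ltnn subnn.
Qed.

Hypothesis sigma_wins :
  forall u b, (forall n, u n = sigma (history u b n)) -> I_wins_play E A u b.

(** Winning is a property of infinite plays only, so the history is first
    continued to a play in which [c] comes next. *)
Lemma reply_forces S h c : history_along S h -> E c (sval (sigma (extend h c))).
Proof.
move=> /(history_along_play c) [u [b [uE hE bc]]].
have [_ /(_ (size h))] := sigma_wins uE.
by rewrite bc uE historyS (uE (size h)) hE bc.
Qed.

Variable S : seq (nonempty_seq X * B) -> set B.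
Hypothesis S_antichain : forall h c d, S h c -> S h d ->
  prefix (sval (sigma (extend h c))) (sval (sigma (extend h d))) -> c = d.
Hypothesis S_minimal : forall h d, exists2 c, S h c &
  prefix (sval (sigma (extend h c))) (sval (sigma (extend h d))).

(** The antichain condition makes a sequence [f] determine, one round at a
    time, the history that runs along it. *)
Lemma history_along_inj f h h' : history_along S h -> history_along S h' ->
  size h = size h' -> oprefix (flatten (position h)) f ->
  oprefix (flatten (position h')) f -> h = h'.
Proof.
move=> h_along; elim: h_along h' => {h} [|h c h_along IHh Sc] h';
  case=> [|{}h' d h'_along Sd] //; rewrite ?size_rcons //.
move=> [size_h]; rewrite !flatten_position_extend => hf h'f.
have eq_h : h = h'.
  apply: IHh => //; first exact: oprefix_prefix (prefix_prefix _ _) hf.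
  exact: oprefix_prefix (prefix_prefix _ _) h'f.
rewrite -eq_h in Sd h'f *; congr extend.
have := oprefix_comparable hf h'f; rewrite !prefix_cat_cancel.
by case=> [/S_antichain->|/S_antichain<-].
Qed.

Lemma position_inj h h' : history_along S h -> history_along S h' ->
  position h = position h' -> h = h'.
Proof.
move=> h_along h'_along eq_p.
have [x0 _] : exists x0 : X, true.
  by case: (sigma h) => -[//|x0 s] _; exists x0.
have size_h : size h = size h'.
  by have /(congr1 size) := eq_p; rewrite !size_rcons !size_map => -[].
apply: (@history_along_inj (nth x0 (flatten (position h)))) => //.
  exact: oprefix_nth.
by rewrite -eq_p; exact: oprefix_nth.
Qed.

Lemma strategy_tree_child h u : history_along S h ->
  strategy_tree S (rcons (position h) u) ->
  exists2 c, S h c & u = sval (sigma (extend h c)).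
Proof.
move=> h_along [/(congr1 size)|[g g_along gE]]; first by rewrite size_rcons.
case: g_along gE => [|{}g c g_along Sc].
  by move=> /(congr1 size); rewrite !size_rcons.
rewrite position_extend => /rcons_inj [eq_p ->].
by have -> := position_inj h_along g_along eq_p; exists c.
Qed.

Lemma strategy_tree_root u :
  strategy_tree S [:: u] -> u = sval (sigma [::]).
Proof.
move=> [//|[h h_along]]; case: h_along => [[]//|{}h c _ _].
by move=> /(congr1 size); rewrite !size_rcons size_map size_rcons.
Qed.

Lemma strategy_tree_belast p u :
  strategy_tree S (rcons p u) -> strategy_tree S p.
Proof.
move=> [/(congr1 size)|[h h_along]]; first by rewrite size_rcons.
case: h_along => [|{}h c h_along _]; first by case: p => [|v [|w p]] //; left.
by rewrite position_extend => /rcons_inj [-> _]; right; exists h.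
Qed.

Lemma strategy_tree_perfect : B_perfect_tree E (strategy_tree S).
Proof.
split=> [p q|p b|p u v].
- move=> /prefixP[t ->]; elim/last_ind: t => [|t u IHt]; first by rewrite cats0.
  by rewrite -rcons_cat => /strategy_tree_belast.
- move=> [->//|[h h_along ->]] _.
  have [c Sc cb] := S_minimal h b.
  exists (sval (sigma (extend h c))), (sval (sigma (extend h b))); split=> //.
  + by case: (sigma _).
  + right; exists (extend h c); first exact: along_extend.
    by rewrite position_extend.
  + exact: reply_forces h_along.
- move=> [->|[h h_along ->]].
    by move=> /strategy_tree_root -> /strategy_tree_root ->.
  move=> /(strategy_tree_child h_along) [c Sc ->].
  move=> /(strategy_tree_child h_along) [d Sd ->] neq.
  by split=> /S_antichain eq_cd; apply: neq; rewrite eq_cd.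
Qed.

Lemma strategy_tree_branches : branches (strategy_tree S) `<=` A.
Proof.
move=> f f_branch.
have along n : exists h, [/\ history_along S h, size h = n &
    oprefix (flatten (position h)) f].
  have [p [[->//|[h h_along ->]] size_h hf]] := f_branch n.
  exists h; split=> //.
  by move: size_h; rewrite size_rcons size_map => -[].
have [h h_P] := choice along.
have next n : exists c, h n.+1 = extend (h n) c.
  have [hn_along size_hn hnf] := h_P n; have [] := h_P n.+1.
  case=> // g c g_along Sc; rewrite size_rcons => -[size_g].
  rewrite flatten_position_extend => gf; exists c; congr extend.
  apply: (@history_along_inj f) => //; first by rewrite size_g size_hn.
  exact: oprefix_prefix (prefix_prefix _ _) gf.
have [b bE] := choice next.
pose u n := sigma (h n).
have histE n : history u b n = h n.
  elim: n => [|n IHn]; last by rewrite historyS IHn bE.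
  by have [_ /size0nil-> _] := h_P 0.
have uE n : u n = sigma (history u b n) by rewrite histE.
have [[g Ag ug] _] := sigma_wins uE.
suff -> : f = g by [].
apply: (@is_concat_inj _ u) => // n.
have [_ _] := h_P n; rewrite -histE position_history // => hnf.
exact: oprefix_prefix (concat_upto_prefix u (leqnSn n)) hnf.
Qed.

Lemma strategy_tree_branch (b0 : B) : branches (strategy_tree S) !=set0.
Proof.
have S_inhabited h : exists c, S h c.
  by have [c Sc _] := S_minimal h b0; exists c.
have [tau tauS] := choice S_inhabited.
have [u [b [uE bE]]] := play_of_strategies sigma (fun h _ => tau h).
have along n : history_along S (history u b n).
  elim: n => [|n IHn]; first exact: along_nil.
  by rewrite historyS uE bE; exact: along_extend.
have [[f _ uf] _] := sigma_wins uE; exists f => n.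
exists (position (history u b n)); split.
- by right; exists (history u b n).
- by rewrite size_rcons size_map size_history.
by rewrite position_history //; exact: uf.
Qed.

End StrategyOfI.

Lemma perfect_of_strategy (X : choiceType) (B : Type) (E : B -> set (seq X))
    (A : set (omega_seq X)) : [set: B] !=set0 -> I_has_winning_strategy E A ->
  exists P, [/\ P `<=` A, P !=set0 & B_perfect E P].
Proof.
move=> [b0 _] [sigma sigma_wins].
have [S S_antichain] := choice (fun h =>
  minimal_antichain (fun c => sval (sigma (extend sigma h c)))).
exists (branches (strategy_tree sigma S)); split.
- exact: strategy_tree_branches sigma_wins _ (fun h => (S_antichain h).1).
- exact: strategy_tree_branch sigma_wins _ (fun h => (S_antichain h).2) b0.
exists (strategy_tree sigma S) => //.
exact: strategy_tree_perfect sigma_wins _ (fun h => (S_antichain h).1)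
  (fun h => (S_antichain h).2).
Qed.

(** * From a perfect set to a winning strategy of I *)

Section ConditionSet.
Variables (X : choiceType) (B : Type) (E : B -> set (seq X)).
Hypothesis hE : condition_set E.

Lemma forcing_neq0 b u : E b u -> u != [::].
Proof. exact: (forcing_sub hE). Qed.

(** Induction on the rank of [b]: if the child [u] does not force [b] yet, what
    is left to force is a condition of smaller rank. *)
Lemma perfect_tree_forces J p b : B_perfect_tree E J -> J p -> p != [::] ->
  exists q, J (p ++ q) /\ E b (flatten q).
Proof.
move=> perfJ; have [l rank_l] := forcing_rank hE.
have [n] := ubnP (l b); elim: n p b => // n IHn p b lbn Jp p_neq0.
have [u [v [u_neq0 uv Jpu Ebv]]] := perfect_split perfJ b Jp p_neq0.
case: (pselect (E b u)) => [Ebu|nEbu].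
  by exists [:: u]; rewrite cats1 /= cats0.
have [c [lc cE]] := rank_l _ _ _ u_neq0 (forcing_neq0 Ebv) uv nEbu Ebv.
have [||q [Jq Ecq]] := IHn (rcons p u) c _ Jpu; first exact: leq_trans lc lbn.
  by case: (p).
exists (u :: q); rewrite -cat_rcons; split=> //.
by apply/cE => //; exact: forcing_neq0 Ecq.
Qed.

Lemma strategy_of_perfect (A P : set (omega_seq X)) :
  P `<=` A -> P !=set0 -> B_perfect E P -> I_has_winning_strategy E A.
Proof.
move=> PA [f0 Pf0] [J perfJ PE].
have [b0 _] := cond_nonempty hE.
(* the first step of a branch may be the empty string, so I opens the game
   only after forcing some condition along the tree *)
have [p0 [m0 [Jp0 p0_neq0 m0E]]] : exists p (m : nonempty_seq X),
    [/\ J p, p != [::] & flatten p = sval m].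
  have [p [Jp size_p _]] : exists s,
      [/\ J s, size s = 1 & oprefix (flatten s) f0].
    by move: Pf0; rewrite PE => /(_ 0).
  have p_neq0 : p != [::] by case: p size_p {Jp}.
  have [q [Jpq Eq]] := perfect_tree_forces b0 perfJ Jp p_neq0.
  have pq_neq0 : flatten (p ++ q) != [::].
    rewrite flatten_cat -size_eq0 size_cat addn_eq0 !size_eq0.
    by rewrite (negPf (forcing_neq0 Eq)) andbF.
  exists (p ++ q), (move_of pq_neq0); split=> //.
  by case: (p) p_neq0.
have step_exists (x : seq (seq X) * B) :
    exists qm : seq (seq X) * nonempty_seq X, J x.1 -> x.1 != [::] ->
    [/\ J (x.1 ++ qm.1), flatten qm.1 = sval qm.2 & E x.2 (sval qm.2)].
  case: x => p b; case: (pselect (J p /\ p != [::])) => [[Jp p_neq0]|no].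
    have [q [Jpq Eq]] := perfect_tree_forces b perfJ Jp p_neq0.
    by exists (q, move_of (forcing_neq0 Eq)).
  by exists ([::], m0) => Jp p_neq0; case: no.
have [next nextP] := choice step_exists.
(* the state of I is the current node of the tree and the move that led to it *)
pose step (st : seq (seq X) * nonempty_seq X) (x : nonempty_seq X * B) :=
  (st.1 ++ (next (st.1, x.2)).1, (next (st.1, x.2)).2).
pose state h := foldl step (p0, m0) h.
exists (fun h => (state h).2) => u b uE.
pose st n := state (history u b n).
have stS n : st n.+1 = step (st n) (u n, b n).
  by rewrite /st historyS /state foldl_rcons.
have node n : J (st n).1 /\ n < size (st n).1.
  elim: n => [|n [Jn n_lt]]; first by split=> //; rewrite lt0n size_eq0.
  have st_neq0 : (st n).1 != [::] by case: (st n).1 n_lt.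
  have [] := nextP ((st n).1, b n) Jn st_neq0.
  rewrite stS /= => Jn' qE _; split=> //; rewrite size_cat -addn1.
  apply: leq_add => //; rewrite lt0n size_eq0; apply/eqP => q0.
  by move: qE; rewrite q0; case: (next _).2 => -[].
have next_st n := nextP ((st n).1, b n) (node n).1.
have {}next_st n : [/\ J (st n.+1).1,
    flatten (st n.+1).1 = flatten (st n).1 ++ sval (st n.+1).2 &
    E (b n) (sval (st n.+1).2)].
  have [|Jn qE Eb] := next_st n; first by case: (st n).1 (node n).2.
  by rewrite stS /= flatten_cat qE.
have st_concat n : flatten (st n).1 = concat_upto u n.+1.
  elim: n => [|n IHn]; first by rewrite concat_uptoS uE.
  have [_ -> _] := next_st n; rewrite IHn [RHS]concat_uptoS.
  by congr (_ ++ sval _); rewrite uE.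
split; last by move=> n; have [_ _] := next_st n; rewrite uE.
have [f uf] := is_concat_exists u; exists f => //; apply: PA; rewrite PE => n.
have [Jn n_lt] := node n; exists (take n.+1 (st n).1); split.
- exact: (perfect_is_tree perfJ) (prefix_take _ _) Jn.
- by rewrite size_takel.
have stf : oprefix (flatten (st n).1) f by rewrite st_concat; exact: uf.
apply: oprefix_prefix stf.
rewrite -[p in prefix _ (flatten p)](cat_take_drop n.+1).
by rewrite flatten_cat prefix_prefix.
Qed.

End ConditionSet.

(** * From a winning strategy of II to meagerness *)

Section Refuting.
Variables (X : choiceType) (B : Type) (E : B -> set (seq X)).

(** With [c v] the answer of II after [v], these are the sequences through [s]
    that defeat I: whatever move past [s] I makes along the sequence, the
    answer is forced by no later segment of it. *)
Definition refuting (s : seq X) (c : seq X -> B) : set (omega_seq X) :=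
  [set f | oprefix s f /\
    forall v w, prefix s v -> oprefix (v ++ w) f -> ~ E (c v) w].

Lemma cyl_open (u : seq X) : open (cyl u).
Proof. by exists [set u] => //; rewrite bigcup_set1. Qed.

(** Failing either clause of [refuting s c] is witnessed by a finite initial
    segment. *)
Lemma refuting_closed s c : closed (refuting s c).
Proof.
rewrite -openC.
pose K := [set u : seq X | cyl u `<=` ~` refuting s c].
suff -> : ~` refuting s c = \bigcup_(u in K) cyl u.
  by apply: bigcup_open => u _; exact: cyl_open.
apply/seteqP; split=> [f nf|f [u Ku uf]]; last exact: Ku.
case: (pselect (oprefix s f)) => [sf|nsf]; last first.
  exists (mkseq f (size s)); last exact: oprefix_mkseq.
  move=> g fg [sg _]; apply: nsf; move: fg sg.
  by rewrite /cyl /= /oprefix size_mkseq => /eqP ->.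
apply: contrapT => no; apply: nf; split=> // v w sv wf Ew; apply: no.
by exists (v ++ w) => // g wg [_ /(_ v w sv wg)].
Qed.

Lemma refuting_nowhere_dense s c : condition_set E ->
  B_nowhere_dense E (refuting s c).
Proof.
move=> hE; split=> [|u [f [sf f_ref] uf]]; first exact: refuting_closed.
case: (oprefix_comparable sf uf) => [su|/prefixP[[|x t] tE]].
- by exists (c u) => v _ [g [_ g_ref]]; exact: g_ref.
- exists (c u) => v _ [g [_ g_ref]]; apply: g_ref.
  by rewrite tE cats0 prefix_refl.
(* a condition that forbids the next entry of [s] leaves [s] for good *)
have [b b_avoid] := forcing_avoid hE x.
exists b => -[//|y v] _ [g [sg _] vg] /b_avoid; apply.
have := oprefix_comparable sg vg.
by rewrite tE !prefix_cat_cancel /= => -[] /andP[/eqP].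
Qed.

End Refuting.

(** If [f] is outside all the sets [D] below, I keeps the play live for [f]:
    instead of a segment [v] that forces the pending condition, I plays the
    extension [t] of [v] after which the answer of [tau] is forced by some
    later segment of [f]. *)
Lemma meager_of_strategy (X : countType) (B : countType) (E : B -> set (seq X))
    (A : set (omega_seq X)) : condition_set E ->
  II_has_winning_strategy E A -> B_meager E A.
Proof.
move=> hE [tau tau_wins].
pose moves (h : seq ({u : seq X | u != [::]} * B)) :=
  flatten [seq sval x.1 | x <- h].
pose answer h (v0 : {u : seq X | u != [::]}) v :=
  tau h (insubd v0 (drop (size (moves h)) v)).
pose D n := if unpickle n is Some (h, v) then
  refuting E (moves h ++ sval v) (answer h v) else set0.
exists D; split=> [n|f Af].
  rewrite /D; case: unpickle => [[h v]|]; first exact: refuting_nowhere_dense.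
  by split=> [|u [f]] //; exact: closed0.
apply: contrapT => notD.
(* before the first move there is no condition, and any move is legal *)
pose legal (h : seq (nonempty_seq X * B)) w :=
  if last None [seq Some x.2 | x <- h] is Some b then E b w else w != [::].
pose live h := exists w, oprefix (moves h ++ w) f /\ legal h w.
have legal_neq0 h w : legal h w -> w != [::].
  by rewrite /legal; case: last => // b; exact: forcing_neq0.
have legal_mono h v w : prefix v w -> legal h v -> legal h w.
  move=> vw v_legal; have v_neq0 := legal_neq0 _ _ v_legal.
  have w_neq0 := prefix_neq0 vw v_neq0.
  move: v_legal; rewrite /legal; case: last => // b.
  exact: forcing_mono hE _ _ _ _ _ vw.
have can_stay h : exists t : nonempty_seq X, live h ->
    [/\ legal h (sval t), oprefix (moves h ++ sval t) f &
        live (rcons h (t, tau h t))].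
  have t0 : nonempty_seq X by exact: (@move_of _ [:: f 0]).
  case: (pselect (live h)) => [[v [vf v_legal]]|dead]; last by exists t0.
  have v_neq0 := legal_neq0 _ _ v_legal.
  pose v' : {u : seq X | u != [::]} := move_of v_neq0.
  apply: contrapT => stuck; apply: notD; exists (pickle (h, v')) => //.
  rewrite /D pickleK; split=> // t w /prefixP[t' tE] wf Ew; apply: stuck.
  have t_neq0 : v ++ t' != [::] := prefix_neq0 (prefix_prefix v t') v_neq0.
  pose t1 : {u : seq X | u != [::]} := move_of t_neq0.
  move: wf Ew; rewrite /answer tE /= -!catA drop_size_cat //.
  rewrite (_ : insubd v' (v ++ t') = t1); last first.
    by apply/val_inj; rewrite val_insubd t_neq0.
  move=> wf Ew; exists t1 => _.
  have {}wf : oprefix ((moves h ++ sval t1) ++ w) f by rewrite /= -!catA.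
  split.
  - exact: legal_mono (prefix_prefix _ _) v_legal.
  - exact: oprefix_prefix (prefix_prefix _ _) wf.
  exists w; rewrite /moves /legal !map_rcons last_rcons flatten_rcons /=.
  by split.
have [sigma sigmaP] := choice can_stay.
have [u [b [uE bE]]] := play_of_strategies sigma tau.
have always_live n : live (history u b n).
  elim: n => [|n /sigmaP[_ _]]; last by rewrite historyS bE uE.
  by exists (mkseq f 1); split => //; exact: oprefix_mkseq.
apply: (tau_wins u b bE); split=> [|n].
  exists f => // n; rewrite -/(concat_upto u n) -(flatten_history _ b).
  have [w [wf _]] := always_live n.
  exact: oprefix_prefix (prefix_prefix _ _) wf.
have [+ _ _] := sigmaP _ (always_live n.+1).
by rewrite -uE /legal historyS map_rcons last_rcons.
Qed.

(** * From meagerness to a winning strategy of II *)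

Lemma strategy_of_meager (X : choiceType) (B : Type) (E : B -> set (seq X))
    (A : set (omega_seq X)) : [set: B] !=set0 ->
  B_meager E A -> II_has_winning_strategy E A.
Proof.
move=> [b0 _] [D [nwdD AD]].
have can_avoid (x : nat * seq X) : exists b, segments (D x.1) x.2 ->
    forall v, v != [::] -> segments (D x.1) (x.2 ++ v) -> ~ E b v.
  case: x => n s; case: (pselect (segments (D n) s)) => [Ds|nDs].
    by have [b bP] := (nwdD n).2 s Ds; exists b.
  by exists b0.
have [avoid avoidP] := choice can_avoid.
exists (fun h m => avoid (size h, flatten [seq sval x.1 | x <- h] ++ sval m)).
move=> u b bE [[f Af uf] Eb].
have [n _ Dnf] := AD f Af.
have bnE : b n = avoid (n, concat_upto u n.+1).
  by rewrite bE size_history flatten_history concat_uptoS.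
have Dn : segments (D n) (concat_upto u n.+1) by exists f => //; exact: uf.
have := Eb n; rewrite bnE; apply: (avoidP (n, _) Dn); first by case: (u n.+1).
by exists f => //=; rewrite -concat_uptoS; exact: uf.
Qed.

Theorem theorem5p4p1 (X : countType) (hX : exists x y : X, x <> y)
    (B : countType) (E : B -> set (seq X)) (hE : condition_set E)
    (A : set (omega_seq X)) :
  (I_has_winning_strategy E A <->
     exists P : set (omega_seq X), [/\ P `<=` A, P !=set0 & B_perfect E P]) /\
  (II_has_winning_strategy E A <-> B_meager E A).
Proof.
have B_neq0 := cond_nonempty hE.
split; split.
- exact: perfect_of_strategy.
- by move=> [P [PA P_neq0 perfP]]; exact: strategy_of_perfect PA P_neq0 perfP.
- exact: meager_of_strategy.
- exact: strategy_of_meager.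
Qed.
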